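(* Let $k,m,n,l\ge1$, let $\mu$ be a measure on $[k]$, and for $1\le i\le n$ let $a^i_1,\dots,a^i_m\subseteq[k]$. Then $$h_l\Big(\bigcup_{i=1}^n\{a^i_1,\dots,a^i_m\}\Big)=\frac{1}{(m!)^{n-1}}\sum_{\substack{\sigma\in\{\mathrm{id}\}\times S_m^{n-1}\\ 1\le t_1\le t_2\le\cdots\le t_l\le m\\ f:[l]\to P([n])\setminus\{\emptyset\}}}\ \prod_{j=1}^{l}(-1)^{|f(j)|+1}\,\mu\Big(\bigcap_{i\in f(j)}a^i_{\sigma_i(t_j)}\Big),$$ where $\sigma=(\sigma_1,\dots,\sigma_n)$ with $\sigma_1=\mathrm{id}$.
   Context: Work over $\mathbb{R}$. $[k]=\{1,\dots,k\}$; $\langle P[k]\rangle$ is the real vector space with basis the subsets of $[k]$, with union the bilinear extension of set union; $\langle P[k]\rangle^{\otimes m}$ has componentwise union and $S_m$ permutes tensor factors. $\mathrm{Sym}^m\langle P[k]\rangle=\langle P[k]\rangle^{\otimes m}/S_m$ (coinvariants), $\{a_1,\dots,a_m\}$ denotes the class of $a_1\otimes\cdots\otimes a_m$, union on it is $\bar u\cup\bar v=\frac{1}{m!}\sum_{\tau\in S_m}\overline{u\cup\tau v}$, and $\bigcup_{i=1}^n$ is the iterated union. A measure on $[k]$ is a map $\mu:P([k])\to\mathbb{R}$ with $\mu(a\cup b)=\mu(a)+\mu(b)$ for disjoint $a,b$. The complete homogeneous symmetric function is $h_l(x_1,\dots,x_m)=\sum_{1\le t_1\le\cdots\le t_l\le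 m}\prod_{j=1}^l x_{t_j}$, and $h_l:\mathrm{Sym}^m\langle P[k]\rangle\to\mathbb{R}$ is the linear map with $h_l(\{a_1,\dots,a_m\})=h_l(\mu(a_1),\dots,\mu(a_m))$. *)

(* Defs.v *)
From HB Require Import structures.
From mathcomp Require Import all_boot all_order all_fingroup all_algebra.
From mathcomp Require Import reals.

Set Implicit Arguments.
Unset Strict Implicit.
Unset Printing Implicit Defensive.

Import Order.TTheory GRing.Theory Num.Theory.

Local Open Scope ring_scope.
Local Open Scope quotient_scope.

Section FreeVectorSpace.
Context (R : realType).

Definition freeV (X : finType) := {ffun X -> R^o}.

Definition bvec (X : finType) (x : X) : freeV X := [ffun y => (y == x)%:R].

Lemma scaleRE (x y : R) : x *: (y : R^o) = x * y. Proof. by []. Qed.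

Lemma freeV_basis (X : finType) (u : freeV X) : u = \sum_x u x *: bvec x.
Proof.
apply/ffunP=> y; rewrite sum_ffunE (bigD1 y) //= !ffunE eqxx.
rewrite big1 ?addr0 ?[_ *: _]mulr1 // => x xy.
by rewrite !ffunE eq_sym (negbTE xy) scaler0.
Qed.

End FreeVectorSpace.

Section TensorPower.
Context (R : realType) (k m : nat).

Definition powV := freeV R {set 'I_k}.

Definition powU (u v : powV) : powV :=
  \sum_(a : {set 'I_k}) \sum_(b : {set 'I_k}) (u a * v b) *: bvec R (a :|: b).

(* The m-th tensor power of powV, coordinatised by its basis of pure tensors
   of basis vectors: the coordinate at b is that of b 0 (x) ... (x) b (m-1). *)
Definition tpow := freeV R {ffun 'I_m -> {set 'I_k}}.

Definition tens (v : 'I_m -> powV) : tpow :=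
  [ffun b : {ffun 'I_m -> {set 'I_k}} => \prod_i v i (b i)].

Definition tpowU (u v : tpow) : tpow :=
  \sum_(a : {ffun 'I_m -> {set 'I_k}}) \sum_(b : {ffun 'I_m -> {set 'I_k}})
    (u a * v b) *: bvec R [ffun i => a i :|: b i].

(* s moves the factor in position i to position s i, see [permT_tens]. *)
Definition permT (s : 'S_m) (u : tpow) : tpow :=
  [ffun b : {ffun 'I_m -> {set 'I_k}} => u [ffun i => b (s i)]].

Lemma tens_bvec (a : 'I_m -> {set 'I_k}) :
  tens (fun i => bvec R (a i)) = bvec R [ffun i => a i].
Proof.
apply/ffunP=> b; rewrite !ffunE; case: eqP => [->|ne].
  by rewrite big1 // => i _; rewrite !ffunE eqxx.
have [i bi] : exists i, b i != a i.
  apply/existsP; apply: contra_notT ne => /existsPn H.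
  by apply/ffunP=> i; rewrite ffunE; apply/eqP; have := H i; rewrite negbK.
by rewrite (bigD1 i) //= ffunE (negbTE bi) mul0r.
Qed.

Lemma powUE (u v : powV) c :
  powU u v c = \sum_a \sum_(b | c == a :|: b) u a * v b.
Proof.
rewrite sum_ffunE; apply: eq_bigr => a _; rewrite sum_ffunE [RHS]big_mkcond /=.
apply: eq_bigr => b _; rewrite !ffunE scaleRE.
by case: (c == _); rewrite ?mulr1 ?mulr0.
Qed.

Lemma tpowUE (u v : tpow) c :
  tpowU u v c =
  \sum_(a : {ffun 'I_m -> {set 'I_k}}) \sum_(b : {ffun 'I_m -> {set 'I_k}} | c == [ffun i => a i :|: b i])
     u a * v b.
Proof.
rewrite sum_ffunE; apply: eq_bigr => a _; rewrite sum_ffunE [RHS]big_mkcond /=.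
apply: eq_bigr => b _; rewrite !ffunE scaleRE.
by case: (c == _); rewrite ?mulr1 ?mulr0.
Qed.

Lemma tpowU_tens (u v : 'I_m -> powV) :
  tpowU (tens u) (tens v) = tens (fun i => powU (u i) (v i)).
Proof.
apply/ffunP=> c; rewrite tpowUE ffunE.
under [RHS]eq_bigr => i _ do rewrite powUE.
rewrite bigA_distr_bigA /=; apply: eq_bigr => a _.
rewrite bigA_distr_big_dep /=; apply: eq_big => [b|b _]; last first.
  by rewrite !ffunE big_split.
apply/eqP/forallP => [-> i|H]; first by rewrite unfold_in ffunE.
by apply/ffunP=> i; rewrite ffunE; apply/eqP; have := H i.
Qed.

Lemma permT_tens (s : 'S_m) (v : 'I_m -> powV) :
  permT s (tens v) = tens (fun i => v ((s^-1)%g i)).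
Proof.
apply/ffunP=> b; rewrite !ffunE (reindex_perm s^-1%g).
by apply: eq_bigr => i _; rewrite ffunE permKV.
Qed.

Fact permT_is_linear s : linear (permT s).
Proof. by move=> c u v; apply/ffunP=> b; rewrite !ffunE. Qed.
HB.instance Definition _ (s : 'S_m) :=
  GRing.isLinear.Build R tpow tpow *:%R (permT s) (permT_is_linear s).

Lemma permT1 u : permT 1%g u = u.
Proof.
apply/ffunP=> b; rewrite ffunE; congr (u _).
by apply/ffunP=> i; rewrite ffunE perm1.
Qed.

Lemma permTM (s t : 'S_m) u : permT (s * t)%g u = permT t (permT s u).
Proof.
apply/ffunP=> b; rewrite !ffunE; congr (u _).
by apply/ffunP=> i; rewrite !ffunE permM.
Qed.

Fact tpowU_is_linear u : linear (tpowU u).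
Proof.
move=> c v w; rewrite /tpowU scaler_sumr -big_split; apply: eq_bigr => a _ /=.
rewrite scaler_sumr -big_split; apply: eq_bigr => b _ /=.
by rewrite !ffunE mulrDr scalerDl scalerA scaleRE mulrCA.
Qed.
HB.instance Definition _ (u : tpow) :=
  GRing.isLinear.Build R tpow tpow *:%R (tpowU u) (tpowU_is_linear u).

Lemma tpowU_sumr u (I : finType) (F : I -> tpow) :
  tpowU u (\sum_i F i) = \sum_i tpowU u (F i).
Proof. exact: linear_sum. Qed.

Lemma tpowUC : commutative tpowU.
Proof.
move=> u v; rewrite /tpowU exchange_big; apply: eq_bigr => a _.
apply: eq_bigr => b _; rewrite mulrC; congr (_ *: bvec R _).
by apply/ffunP=> i; rewrite !ffunE setUC.
Qed.

Lemma tpowU_bvec a b :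
  tpowU (bvec R a) (bvec R b) = bvec R [ffun i => a i :|: b i].
Proof.
rewrite /tpowU (bigD1 a) //= (bigD1 b) //= !ffunE !eqxx mulr1 scale1r.
rewrite !big1 ?addr0 // => [a' ne|b' ne].
  by apply: big1 => b' _; rewrite !ffunE (negbTE ne) mul0r scale0r.
by rewrite !ffunE (negbTE ne) mulr0 scale0r.
Qed.

Lemma tpowU_bvecr u b :
  tpowU u (bvec R b) = \sum_a u a *: bvec R [ffun i => a i :|: b i].
Proof.
rewrite tpowUC [in LHS](freeV_basis u) tpowU_sumr; apply: eq_bigr => a _.
by rewrite linearZ /= tpowUC tpowU_bvec.
Qed.

Lemma permT_tpowU s u v :
  permT s (tpowU u v) = tpowU (permT s u) (permT s v).
Proof.
pose h (r : 'S_m) (a : {ffun 'I_m -> {set 'I_k}}) := [ffun i => a (r i)].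
have hK r : cancel (h r) (h r^-1%g).
  by move=> a; apply/ffunP=> i; rewrite !ffunE permKV.
have hKV r : cancel (h r^-1%g) (h r).
  by move=> a; apply/ffunP=> i; rewrite !ffunE permK.
rewrite /tpowU linear_sum (reindex (h s)) /=; last first.
  by exists (h s^-1%g) => x _; rewrite ?hK ?hKV.
apply: eq_bigr => a _; rewrite linear_sum (reindex (h s)) /=; last first.
  by exists (h s^-1%g) => x _; rewrite ?hK ?hKV.
apply: eq_bigr => b _; rewrite linearZ /= !ffunE; congr (_ *: _).
apply/ffunP=> c; rewrite !ffunE; congr (nat_of_bool _)%:R.
apply/eqP/eqP => /ffunP E; apply/ffunP => i; last first.
  by rewrite !ffunE E !ffunE.
by have := E (s^-1%g i); rewrite !ffunE permKV.
Qed.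

Lemma tpowUA : associative tpowU.
Proof.
move=> u v w; rewrite (freeV_basis w) (tpowU_sumr v) !tpowU_sumr.
apply: eq_bigr => c _; rewrite !linearZ /=; congr (_ *: _).
rewrite tpowU_bvecr tpowU_sumr tpowUC [in RHS](freeV_basis v).
rewrite (tpowU_sumr u) tpowU_sumr.
apply: eq_bigr => b _; rewrite !linearZ /=; congr (_ *: _).
rewrite !tpowU_bvecr tpowU_sumr; apply: eq_bigr => a _.
rewrite linearZ /= tpowU_bvec; congr (_ *: bvec R _).
by apply/ffunP=> i; rewrite !ffunE setUA setUC.
Qed.

End TensorPower.

Section SymmetricPower.
Context (R : realType) (k m : nat).
Local Notation T := (tpow R k m).

(* The span of all the permT s u - u. *)
Definition coinvK : {vspace T} :=
  (\sum_(s : 'S_m) limg (linfun (permT s) - \1%VF))%VS.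

Definition symP := Quotient.quot (coinvK : zmodClosed T).
HB.instance Definition _ := GRing.Zmodule.on symP.

Definition cls (u : T) : symP := \pi_(Quotient.quot (coinvK : zmodClosed T)) u.

Definition rep (x : symP) : T :=
  generic_quotient.repr (x : Quotient.quot (coinvK : zmodClosed T)).

Lemma clsP u v : (cls u == cls v) = (u - v \in coinvK).
Proof. by rewrite -Quotient.idealrBE. Qed.

Lemma eq_cls u v : u - v \in coinvK -> cls u = cls v.
Proof. by rewrite -clsP => /eqP. Qed.

Lemma cls_rep (x : symP) : cls (rep x) = x.
Proof. exact: reprK. Qed.

Lemma rep_cls u : rep (cls u) - u \in coinvK.
Proof. by rewrite -clsP cls_rep. Qed.

Fact cls_is_additive : zmod_morphism cls.
Proof. by move=> u v; rewrite /cls raddfB. Qed.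

Definition symZ (c : R) (x : symP) : symP := cls (c *: rep x).

Fact symZ_cls c u : symZ c (cls u) = cls (c *: u).
Proof. by apply: eq_cls; rewrite -scalerBr memvZ // rep_cls. Qed.

Fact symZA c d x : symZ c (symZ d x) = symZ (c * d) x.
Proof. by rewrite -(cls_rep x) !symZ_cls scalerA. Qed.

Fact symZ1 : left_id 1 symZ.
Proof. by move=> x; rewrite -(cls_rep x) symZ_cls scale1r. Qed.

Let clsD u v : cls (u + v) = cls u + cls v.
Proof.
have cls0 : cls 0 = 0 by rewrite -(subrr 0) cls_is_additive subrr.
by rewrite -[v in LHS]opprK -[- v]sub0r !cls_is_additive cls0 sub0r opprK.
Qed.

Fact symZDr : right_distributive symZ +%R.
Proof.
move=> c x y; rewrite -(cls_rep x) -(cls_rep y) -clsD.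
by rewrite !symZ_cls scalerDr clsD.
Qed.

Fact symZDl x : {morph symZ^~ x : c d / c + d}.
Proof. by move=> c d; rewrite -(cls_rep x) !symZ_cls scalerDl clsD. Qed.

HB.instance Definition _ :=
  GRing.Zmodule_isLmodule.Build R symP symZA symZ1 symZDr symZDl.

Fact cls_is_linear : linear cls.
Proof. by move=> c u v; rewrite clsD -symZ_cls. Qed.
HB.instance Definition _ :=
  GRing.isLinear.Build R T symP *:%R cls cls_is_linear.

Let permBE s u : (linfun (@permT R k m s) - \1%VF)%R u = permT s u - u.
Proof. by rewrite add_lfunE opp_lfunE id_lfunE lfunE. Qed.

Lemma coinvKP u :
  reflect (exists v : 'S_m -> T, u = \sum_s (permT s (v s) - v s))
          (u \in coinvK).
Proof.
apply: (iffP memv_sumP) => [[w Hw ->]|[v ->]]; last first.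
  exists (fun s => permT s (v s) - v s) => // s _.
  by rewrite -permBE memv_img ?memvf.
have /fin_all_exists [v Hv] : forall s, exists v, w s = permT s v - v.
  by move=> s; have /memv_imgP[v _ ->] := Hw s isT; exists v; apply: permBE.
by exists v; apply: eq_bigr => s _.
Qed.

Lemma permT_coinvK s u : permT s u - u \in coinvK.
Proof.
rewrite -permBE; apply: (subvP (sumv_sup s isT (subvv _))).
by rewrite memv_img ?memvf.
Qed.

Lemma cls_permT s u : cls (permT s u) = cls u.
Proof. exact: eq_cls (permT_coinvK s u). Qed.

Lemma coinvK_eq (V : lmodType R) (f : T -> V) :
    linear f -> (forall s u, f (permT s u) = f u) ->
  forall u v, u - v \in coinvK -> f u = f v.
Proof.
move=> flin finv u v /coinvKP[w Ew].
pose F : {linear T -> V} :=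
  HB.pack f (GRing.isLinear.Build R T V *:%R f flin).
apply/eqP; rewrite -subr_eq0 -[f u - f v]/(F u - F v) -linearB Ew linear_sum.
by rewrite big1 // => s _; rewrite linearB /= finv subrr.
Qed.

(* Independent of the chosen representatives, see [symU_cls]. *)
Definition symU (x y : symP) : symP :=
  (m`!%:R)^-1 *: \sum_(s : 'S_m) cls (tpowU (rep x) (permT s (rep y))).

Lemma symU_cls u v :
  symU (cls u) (cls v) =
  (m`!%:R)^-1 *: \sum_(s : 'S_m) cls (tpowU u (permT s v)).
Proof.
congr (_ *: _).
have linr u0 : linear (fun w => \sum_(s : 'S_m) cls (tpowU u0 (permT s w))).
  move=> c w1 w2; rewrite scaler_sumr -big_split; apply: eq_bigr => s _ /=.
  by rewrite (linearP (permT s)) (linearP (tpowU u0)) (linearP cls).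
have linl v0 : linear (fun w => \sum_(s : 'S_m) cls (tpowU w (permT s v0))).
  move=> c w1 w2; rewrite scaler_sumr -big_split; apply: eq_bigr => s _ /=.
  by rewrite !(tpowUC _ (permT s v0)) (linearP (tpowU _)) (linearP cls).
transitivity (\sum_(s : 'S_m) cls (tpowU (rep (cls u)) (permT s v))).
  apply: (coinvK_eq (linr _)) (rep_cls v) => t w.
  under eq_bigr => s _ do rewrite -permTM.
  by rewrite [RHS](reindex_inj (mulgI t)).
apply: (coinvK_eq (linl _)) (rep_cls u) => t w.
rewrite [RHS](reindex_inj (mulIg t^-1%g)) /=; apply: eq_bigr => s _.
by rewrite -(cls_permT t^-1%g) permT_tpowU -!permTM mulgV permT1.
Qed.

Lemma symUC : commutative symU.
Proof.
move=> x y; rewrite -(cls_rep x) -(cls_rep y) !symU_cls; congr (_ *: _).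
rewrite (reindex_inj invg_inj); apply: eq_bigr => s _ /=.
by rewrite -(cls_permT s) permT_tpowU -permTM mulVg permT1 tpowUC.
Qed.

Let fact_neq0 : m`!%:R != 0 :> R.
Proof. by rewrite pnatr_eq0 -lt0n fact_gt0. Qed.

Fact symU_is_linear x : linear (symU x).
Proof.
move=> c y z; rewrite -(cls_rep x) -(cls_rep y) -(cls_rep z) -linearP.
rewrite !symU_cls scalerA mulrC -scalerA -scalerDr; congr (_ *: _).
rewrite scaler_sumr -big_split; apply: eq_bigr => s _ /=.
by rewrite -linearP -[in RHS]linearP -linearP.
Qed.
HB.instance Definition _ (x : symP) :=
  GRing.isLinear.Build R symP symP *:%R (symU x) (symU_is_linear x).

Lemma symUA : associative symU.
Proof.
move=> x y z; rewrite -(cls_rep x) -(cls_rep y) -(cls_rep z).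
set u := rep x; set v := rep y; set w := rep z.
rewrite [symU (cls v) _]symU_cls [symU (cls u) (cls v)]symU_cls.
rewrite (symUC _ (cls w)).
rewrite (linearZZ (symU (cls u))) (linearZZ (symU (cls w))) /=.
congr (_ *: _).
rewrite (linear_sum (symU (cls u))) (linear_sum (symU (cls w))) /=.
under eq_bigr => s _ do rewrite symU_cls.
under [RHS]eq_bigr => s _ do rewrite symUC symU_cls.
rewrite -!scaler_sumr; congr (_ *: _).
rewrite exchange_big; apply: eq_bigr => s _ /=.
rewrite (reindex_inj (mulIg s^-1%g)); apply: eq_bigr => t _ /=.
by rewrite permT_tpowU -permTM mulgKV tpowUA.
Qed.

(* The class {a 0, ..., a (m-1)} of a 0 (x) ... (x) a (m-1). *)
Definition symcls (a : 'I_m -> {set 'I_k}) : symP :=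
  cls (tens (fun i => bvec R (a i))).

Definition sym0 : symP := symcls (fun=> set0).

Lemma symU0s : left_id sym0 symU.
Proof.
move=> x; rewrite -(cls_rep x) symU_cls tens_bvec.
under eq_bigr => s _.
  rewrite tpowUC tpowU_bvecr.
  under eq_bigr => b _.
    have -> : [ffun i => b i :|: [ffun=> set0] i] = b
      by apply/ffunP=> i; rewrite !ffunE setU0.
    over.
  rewrite -freeV_basis cls_permT.
  over.
by rewrite sumr_const card_Sn -scaler_nat scalerA mulVf ?scale1r.
Qed.

End SymmetricPower.

HB.instance Definition _ (R : realType) (k m : nat) :=
  Monoid.isComLaw.Build (symP R k m) (sym0 R k m) (@symU R k m)
    (@symUA R k m) (@symUC R k m) (@symU0s R k m).

Definition is_measure (R : realType) (k : nat) (mu : {set 'I_k} -> R) : Prop :=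
  forall a b : {set 'I_k}, [disjoint a & b] -> mu (a :|: b) = mu a + mu b.

Section CompleteHomogeneous.
Context (R : realType).

Definition hsym (l m : nat) (x : 'I_m -> R) : R :=
  \sum_(t : l.-tuple 'I_m | sorted leq [seq val i | i <- t])
    \prod_(j < l) x (tnth t j).

Lemma hsym_perm l m (x : 'I_m -> R) (s : 'S_m) :
  hsym l (fun i => x (s i)) = hsym l x.
Proof.
pose le (i j : 'I_m) := (i <= j)%N.
have le_tot : total le by move=> i j; apply: leq_total.
have le_tr : transitive le by move=> i j p; apply: leq_trans.
have le_anti : antisymmetric le.
  by move=> i j /anti_leq/val_inj.
pose g (r : 'S_m) (t : l.-tuple 'I_m) : l.-tuple 'I_m :=
  [tuple of sort le [tuple of map r t]].
have srt (t : l.-tuple 'I_m) : sorted leq [seq val i | i <- t] = sorted le t.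
  by rewrite sorted_map.
have gS r t : sorted le (g r t) by apply: sort_sorted.
have gP r t : perm_eq (g r t) (map r t) by rewrite perm_sort.
have gK (r r' : 'S_m) (t : l.-tuple 'I_m) :
    cancel r r' -> sorted le t -> g r' (g r t) = t.
  move=> rK st; apply: val_inj.
  apply: (sorted_eq le_tr le_anti (gS _ _) st).
  apply: (perm_trans (gP _ _)); rewrite -[X in perm_eq _ X](mapK rK).
  exact: perm_map.
rewrite /hsym [RHS](reindex_onto (g s) (g s^-1%g)); last first.
  by move=> t; rewrite srt => st; apply: gK => //; apply: permKV.
apply: eq_big => [t|t _]; last first.
  rewrite -[RHS](big_tuple _ _ (g s t) xpredT x).
  rewrite -[LHS](big_tuple _ _ t xpredT (x \o s)).
  by rewrite (perm_big _ (gP s t)) big_map.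
rewrite !srt gS /=; apply/idP/eqP => [st|<-]; last exact: gS.
by apply: gK => //; apply: permK.
Qed.

Context (k m : nat) (mu : {set 'I_k} -> R) (l : nat).

Let hT (u : tpow R k m) : R := \sum_b u b * hsym l (fun i => mu (b i)).

(* The linear map symP -> R with values on the spanning set given by
   [hlin_symcls]; it does not depend on the representatives, see [hlin_cls]. *)
Definition hlin (x : symP R k m) : R :=
  \sum_(b : {ffun 'I_m -> {set 'I_k}}) rep x b * hsym l (fun i => mu (b i)).

Lemma hlin_cls (u : tpow R k m) :
  hlin (cls u) =
  \sum_(b : {ffun 'I_m -> {set 'I_k}}) u b * hsym l (fun i => mu (b i)).
Proof.
have hlinear : linear (hT : tpow R k m -> R^o).
  move=> c v w; rewrite scaleRE mulr_sumr -big_split; apply: eq_bigr => b _ /=.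
  by rewrite !ffunE mulrDl mulrA.
apply: (coinvK_eq hlinear) (rep_cls u) => s v.
pose c (r : 'S_m) (b : {ffun 'I_m -> {set 'I_k}}) := [ffun i => b (r i)].
rewrite /hT [RHS](reindex (c s)); last first.
  exists (c s^-1%g) => b _; apply/ffunP => i; rewrite !ffunE.
    by rewrite permKV.
  by rewrite permK.
apply: eq_bigr => b _; rewrite !ffunE; congr (_ * _).
rewrite -(hsym_perm l _ s); rewrite /hsym; apply: eq_bigr => t _.
by apply: eq_bigr => j _; rewrite ffunE.
Qed.

Fact hlin_is_linear : linear (hlin : symP R k m -> R^o).
Proof.
move=> c x y; rewrite -(cls_rep x) -(cls_rep y) -linearP !hlin_cls.
rewrite scaleRE mulr_sumr -big_split; apply: eq_bigr => b _ /=.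
by rewrite !ffunE mulrDl mulrA.
Qed.

Lemma hlin_symcls (a : 'I_m -> {set 'I_k}) :
  hlin (symcls R a) = hsym l (fun i => mu (a i)).
Proof.
rewrite /symcls hlin_cls tens_bvec (bigD1 [ffun i => a i]) //= ffunE eqxx.
rewrite mul1r big1 ?addr0 => [|b ne]; last by rewrite ffunE (negbTE ne) mul0r.
by rewrite /hsym; apply: eq_bigr => t _; apply: eq_bigr => j _; rewrite ffunE.
Qed.

End CompleteHomogeneous.

(* Main.v *)
Require Import Defs.
From HB Require Import structures.
From mathcomp Require Import all_boot all_order all_fingroup all_algebra.
From mathcomp Require Import reals.

(** Up to the factor [1 / m!], the union of two classes is the class of [u] joined
    with the [S_m]-orbit sum of [v].  By associativity the iterated union is
    [1 / (m!)^(n-1)] times the class of the first tensor joined with the orbit sums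
    of all the others; distributing union over these sums produces the sum over
    [{id} x S_m^(n-1)] of classes of unions of basis tensors.  Inclusion-exclusion
    for [mu] on each of these unions, distributed over the product of [l] factors
    in [h_l], produces the sum over [f]. *)

Set Implicit Arguments.
Unset Strict Implicit.
Unset Printing Implicit Defensive.

Import Order.TTheory GRing.Theory Num.Theory.

Local Open Scope ring_scope.

Lemma measure_set0 (R : realType) (k : nat) (mu : {set 'I_k} -> R) :
  is_measure mu -> mu set0 = 0.
Proof.
move=> mu_measure; apply: (@addrI _ (mu set0)); rewrite addr0.
by rewrite -mu_measure ?setU0 // disjoints_subset sub0set.
Qed.

(** Being a sum of point masses, [mu] inherits every linear identity between indicator functions of
    sets. *)
Lemma measure_sum_points (R : realType) (k : nat) (mu : {set 'I_k} -> R)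
    (a : {set 'I_k}) :
  is_measure mu -> mu a = \sum_x (x \in a)%:R * mu [set x].
Proof.
move=> mu_measure.
have -> : \sum_x (x \in a)%:R * mu [set x] = \sum_(x in a) mu [set x].
  rewrite [RHS]big_mkcond; apply: eq_bigr => x _.
  by case: (x \in a); rewrite ?mul1r ?mul0r.
have [N] := ubnP #|a|; elim: N a => // N IHN a /ltnSE aN.
have [->|/set0Pn[x xa]] := eqVneq a set0.
  by rewrite big_set0 measure_set0.
rewrite (big_setD1 x) //= -IHN; last by rewrite (cardsD1 x) xa in aN.
by rewrite -mu_measure ?setD1K // disjoints1 !inE eqxx.
Qed.

(** Expand the product of the indicators of the complements of the [b i], which is the indicator of
    the complement of the union. *)
Lemma bigcup_indicator (R : comNzRingType) (I T : finType) (b : I -> {set T})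
    (x : T) :
  (x \in \bigcup_i b i)%:R =
  \sum_(A : {set I} | A != set0)
    (-1) ^+ (#|A| + 1) * (x \in \bigcap_(i in A) b i)%:R :> R.
Proof.
have bigcapE (A : {set I}) :
    (x \in \bigcap_(i in A) b i)%:R = \prod_(i in A) (x \in b i)%:R :> R.
  case: bigcapP => [xA|xNA]; first by rewrite big1 // => i /xA ->.
  have [i iA xNi] : exists2 i, i \in A & x \notin b i.
    apply/exists_inP; apply: contra_notT xNA => /exists_inPn xA i /xA.
    by rewrite negbK.
  by rewrite (bigD1 i) //= (negbTE xNi) mul0r.
have : \prod_i (- (x \in b i)%:R + 1) = 1 - (x \in \bigcup_i b i)%:R :> R.
  case: bigcupP => [[i _ xi]|xN].
    by rewrite subrr (bigD1 i) //= xi addNr mul0r.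
  rewrite subr0 big1 // => i _.
  by case xi: (x \in b i); rewrite ?oppr0 ?add0r //; case: xN; exists i.
(* [A] collects the factors contributing their indicator rather than 1; the term at [set0] is 1 and
   cancels the 1 on the right. *)
rewrite bigA_distr (bigD1 set0) //= big1 => [|i _]; last by rewrite inE.
move=> /addrI /eqP; rewrite -eqr_oppLR => /eqP <-; rewrite -sumrN.
apply: eq_bigr => A _; rewrite bigcapE -big_mkcond /= prodrN.
by rewrite addn1 exprS mulN1r mulNr.
Qed.

Lemma measure_bigcup (R : realType) (k : nat) (mu : {set 'I_k} -> R)
    (I : finType) (b : I -> {set 'I_k}) :
  is_measure mu ->
  mu (\bigcup_i b i) =
  \sum_(A : {set I} | A != set0)
    (-1) ^+ (#|A| + 1) * mu (\bigcap_(i in A) b i).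
Proof.
move=> mu_measure; rewrite (measure_sum_points _ mu_measure).
transitivity (\sum_x \sum_(A : {set I} | A != set0)
    (-1) ^+ (#|A| + 1) * (x \in \bigcap_(i in A) b i)%:R * mu [set x]).
  by apply: eq_bigr => x _; rewrite bigcup_indicator mulr_suml.
rewrite exchange_big; apply: eq_bigr => A _ /=.
rewrite (measure_sum_points (\bigcap_(i in A) b i) mu_measure) mulr_sumr.
by apply: eq_bigr => x _; rewrite mulrA.
Qed.

Lemma hsym_bigcup (R : realType) (k m l : nat) (mu : {set 'I_k} -> R)
    (I : finType) (b : I -> 'I_m -> {set 'I_k}) :
  is_measure mu ->
  hsym l (fun p => mu (\bigcup_i b i p)) =
  \sum_(t : l.-tuple 'I_m | sorted leq [seq val i | i <- t])
  \sum_(f : {ffun 'I_l -> {set I}} | [forall j, f j != set0])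
    \prod_(j < l)
      ((-1) ^+ (#|f j| + 1) * mu (\bigcap_(i in f j) b i (tnth t j))).
Proof.
move=> mu_measure; apply: eq_bigr => t _.
under eq_bigr => j _ do rewrite measure_bigcup //.
by rewrite bigA_distr_big_dep.
Qed.

Section OrbitSums.
Context (R : realType) (k m : nat).
Local Notation T := (tpow R k m).

(** The unit of [tpowU], with class [sym0]. *)
Definition tpow0 : T := bvec R [ffun=> set0].

Lemma tpowUs0 : right_id tpow0 (@tpowU R k m).
Proof.
move=> u; rewrite tpowU_bvecr [RHS]freeV_basis; apply: eq_bigr => b _.
by congr (_ *: bvec R _); apply/ffunP=> i; rewrite !ffunE setU0.
Qed.

Lemma tpowU_zerol : left_zero 0 (@tpowU R k m).
Proof. by move=> u; rewrite tpowUC linear0. Qed.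

Lemma tpowU_zeror : right_zero 0 (@tpowU R k m).
Proof. by move=> u; rewrite linear0. Qed.

Lemma tpowUDl : left_distributive (@tpowU R k m) +%R.
Proof. by move=> u v w; rewrite !(tpowUC _ w) linearD. Qed.

Lemma tpowUDr : right_distributive (@tpowU R k m) +%R.
Proof. by move=> u v w; rewrite linearD. Qed.

(** This instance and those after [tpow_add] let the generic product-of-sums expansion run with
    [tpowU] as the product. *)
HB.instance Definition _ := Monoid.isMulLaw.Build T 0 (@tpowU R k m)
  tpowU_zerol tpowU_zeror.

(* An alias of [+%R], whose canonical [Monoid.add_law] is the one for the ring
   product. *)
Definition tpow_add (u v : T) : T := u + v.

HB.instance Definition _ := Monoid.isComLaw.Build T 0 tpow_add
  (@addrA T) (@addrC T) (@add0r T).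
HB.instance Definition _ := Monoid.isAddLaw.Build T (@tpowU R k m) tpow_add
  tpowUDl tpowUDr.

Lemma big_tpowU_distr (I J : finType) (Q : I -> pred J) (F : I -> J -> T) :
  \big[@tpowU R k m/tpow0]_i \sum_(j | Q i j) F i j =
  \sum_(g in family Q) \big[@tpowU R k m/tpow0]_i F i (g i).
Proof. exact: (@bigA_distr_big_dep _ _ tpow0 _ tpow_add). Qed.

(* Summing over inverses makes [permT] act on basis tensors by precomposition
   with [s], see [permTV_bvec]. *)
Definition orbit_sum (u : T) : T := \sum_(s : 'S_m) permT s^-1%g u.

Lemma permTV_bvec (s : 'S_m) (a : 'I_m -> {set 'I_k}) :
  permT s^-1%g (bvec R [ffun i => a i]) = bvec R [ffun i => a (s i)].
Proof. by rewrite -tens_bvec permT_tens invgK tens_bvec. Qed.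

Lemma symU_cls_orbit_sum (u v : T) :
  symU (cls u) (cls v) = (m`!%:R)^-1 *: cls (tpowU u (orbit_sum v)).
Proof.
rewrite symU_cls; congr (_ *: _).
rewrite /orbit_sum tpowU_sumr linear_sum /=.
by rewrite [RHS](reindex_inj invg_inj); apply: eq_bigr => s _; rewrite invgK.
Qed.

(** The free left factor [v] absorbs one orbit sum per induction step, each costing a factor 1/m!;
    [v] itself is never averaged. *)
Lemma symU_big_cls (I : Type) (r : seq I) (u : I -> T) (v : T) :
  symU (cls v) (\big[@symU R k m/sym0 R k m]_(i <- r) cls (u i)) =
  (m`!%:R ^+ size r)^-1 *:
    cls (tpowU v (\big[@tpowU R k m/tpow0]_(i <- r) orbit_sum (u i))).
Proof.
elim: r v => [|i r IHr] v.
  by rewrite !big_nil invr1 scale1r tpowUs0 symUC symU0s.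
(* Linearity is declared in the right argument of [symU], so commutativity brings the scalar there
   and back. *)
rewrite !big_cons symUA symU_cls_orbit_sum symUC linearZ /= symUC IHr.
by rewrite scalerA tpowUA exprS invfM.
Qed.

Lemma big_tpowU_bvec (I : finType) (b : I -> 'I_m -> {set 'I_k}) :
  \big[@tpowU R k m/tpow0]_i bvec R [ffun p => b i p] =
  bvec R [ffun p => \bigcup_i b i p].
Proof.
have E (r : seq I) : \big[@tpowU R k m/tpow0]_(i <- r) bvec R [ffun p => b i p]
    = bvec R [ffun p => \bigcup_(i <- r) b i p].
  elim: r => [|i r IHr].
    by rewrite big_nil; congr bvec; apply/ffunP=> p; rewrite !ffunE big_nil.
  rewrite big_cons IHr tpowU_bvec; congr bvec; apply/ffunP=> p.
  by rewrite !ffunE big_cons.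
exact: E.
Qed.

Lemma big_symU_symcls (n : nat) (a : 'I_n.+1 -> 'I_m -> {set 'I_k}) :
  \big[@symU R k m/sym0 R k m]_(i < n.+1) symcls R (a i) =
  (m`!%:R ^+ n)^-1 *:
    \sum_(sigma : {ffun 'I_n.+1 -> 'S_m} |
            [forall i : 'I_n.+1, (val i == 0%N) ==> (sigma i == 1%g)])
      symcls R (fun p => \bigcup_i a i (sigma i p)).
Proof.
(* [Q] leaves only the identity at index 0, so the first tensor, which has no orbit sum, fits into a
   uniform product of sums. *)
pose Q (i : 'I_n.+1) (s : 'S_m) := (val i == 0%N) ==> (s == 1%g).
pose u i := bvec R [ffun p => a i p].
rewrite big_ord_recl /symcls.
under eq_bigr => i _ do rewrite tens_bvec.
rewrite tens_bvec -/(u ord0) (symU_big_cls _ (fun i => u (lift ord0 i))).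
(* The exponent is the size of the enumeration of the [n] indices after the first. *)
rewrite -sum1_size sum1_card card_ord; congr (_ *: _).
transitivity (cls (\big[@tpowU R k m/tpow0]_i
    \sum_(s | Q i s) permT s^-1%g (u i))).
  rewrite big_ord_recl /Q /= big_pred1_eq invg1 permT1.
  by congr (cls (tpowU _ _)); apply: eq_bigr.
rewrite big_tpowU_distr linear_sum /=; apply: eq_bigr => sigma _.
under eq_bigr => i _ do rewrite permTV_bvec.
by rewrite (big_tpowU_bvec (fun i p => a i (sigma i p))) tens_bvec.
Qed.

End OrbitSums.

Theorem theorem4p9 (R : realType) (k m n l : nat)
    (hk : (0 < k)%N) (hm : (0 < m)%N) (hn : (0 < n)%N) (hl : (0 < l)%N)
    (mu : {set 'I_k} -> R) (hmu : is_measure mu)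
    (a : 'I_n -> 'I_m -> {set 'I_k}) :
  hlin mu l (\big[@symU R k m/sym0 R k m]_(i < n) symcls R (a i)) =
  (m`!%:R ^+ n.-1)^-1 *
    \sum_(sigma : {ffun 'I_n -> 'S_m} |
            [forall i : 'I_n, (val i == 0%N) ==> (sigma i == 1%g)])
    \sum_(t : l.-tuple 'I_m | sorted leq [seq val i | i <- t])
    \sum_(f : {ffun 'I_l -> {set 'I_n}} | [forall j, f j != set0])
      \prod_(j < l)
        ((-1) ^+ (#|f j| + 1) *
           mu (\bigcap_(i in f j) a i (sigma i (tnth t j)))).
Proof.
case: n hn a => // n _ a; rewrite big_symU_symcls.
(* Bundling [hlin] as a linear map lets it pass through the scalar and the sum over [sigma]. *)
pose H : {linear symP R k m -> R^o} := HB.pack (hlin mu l : _ -> R^o)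
  (GRing.isLinear.Build R (symP R k m) R^o *:%R _ (hlin_is_linear mu l)).
rewrite -[hlin mu l _]/(H _) linearZ linear_sum /= scaleRE; congr (_ * _).
apply: eq_bigr => sigma _; rewrite hlin_symcls.
exact: (hsym_bigcup l (fun i p => a i (sigma i p)) hmu).
Qed.
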